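(* Let $k$ be a field, $\sigma$ an arbitrary index set, and fix a monomial order on the exponent vectors of $k[x_i]_{i\in\sigma}$. A set $G\subseteq k[x_i]_{i\in\sigma}$ is a Gröbner basis of the ideal $\langle G\rangle$ if and only if for all $f,g\in G$, $0$ is a remainder of the $S$-polynomial $\mathrm{S}(f,g)$ on division by $G$.
   Context: Let $\mathcal{M} = (\sigma \to_0 \mathbb{N})$ be the set of finitely supported functions $\sigma\to\mathbb{N}$ (exponent vectors); $\sigma$ may be infinite. A monomial order is a binary relation $\le$ on $\mathcal{M}$ such that (1) $\le$ is a well-order (a linear order with no infinite strictly descending chain), (2) $a\le b$ implies $a+c\le b+c$ for all $a,b,c\in\mathcal{M}$, and (3) $0\le a$ for all $a\in\mathcal{M}$. For a nonzero polynomial $f=\sum_{j\in\mathcal{M}} a_j x^j$, its degree is $\deg(f)=\max\{j\in\mathcal{M} : a_j\ne 0\}$ (maximum with respect to the monomial order), its leading coefficient is $\mathrm{LC}(f)=a_{\deg(f)}$, its leading monomial is $\mathrm{LM}(f)=x^{\deg(f)}$ and its leading term is $\mathrm{LT}(f)=\mathrm{LC}(f)\,\mathrm{LM}(f)$. For the zero polynomial, $\deg(0)=\bot$, an adjoined element strictly smaller than all exponent vectors, and $\mathrm{LM}(0)=0$, $\mathrm{LT}(0)=0$, $\mathrm{LC}(0)=0$. Remainder: let $f$ be a polynomial and $B$ a set of polynomials. A polynomial $r$ is called a remainder of $f$ on division by $B$ if there is a finitely supported function $g:B\to k[x_i]_{i\in\sigma}$ such that (1) $f=\sum_{b\in B}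 g(b)\,b + r$; (2) $\deg(g(b)b)\le\deg(f)$ for every $b\in B$; and (3) no term of $r$ is divisible by the leading monomial of any nonzero element of $B$. Gröbner basis: a subset $G$ (possibly infinite) of an ideal $I\subseteq k[x_i]_{i\in\sigma}$ is a Gröbner basis of $I$ if $\langle \mathrm{LT}(G)\rangle=\langle \mathrm{LT}(I)\rangle$, where $\mathrm{LT}(G)$, $\mathrm{LT}(I)$ are the sets of leading terms of elements of $G$, $I$, and $\langle\cdot\rangle$ denotes the ideal generated. $S$-polynomial: for nonzero $f,g$, with $x^\gamma$ the least common multiple of $\mathrm{LM}(f)$ and $\mathrm{LM}(g)$, $$\mathrm{S}(f,g)=\frac{\mathrm{LC}(g)\,x^\gamma}{\mathrm{LM}(f)}\cdot f-\frac{\mathrm{LC}(f)\,x^\gamma}{\mathrm{LM}(g)}\cdot g .$$ If $f=0$ or $g=0$, then $\mathrm{S}(f,g)=0$. *)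

(* Defs.v *)
From HB Require Import structures.
From mathcomp Require Import all_boot all_order all_algebra.
From mathcomp Require Import finmap monalg.
From mathcomp Require Import boolp classical_sets.

Set Implicit Arguments.
Unset Strict Implicit.
Unset Printing Implicit Defensive.

Import GRing.Theory.

Local Open Scope classical_set_scope.
Local Open Scope ring_scope.

(* {cmonom I} is the type of finitely supported functions I -> nat, written
   multiplicatively: mone is the zero exponent vector and mmul is pointwise
   addition. {malg k[{cmonom I}]} is then k[x_i]_{i in I}, with f@_m the
   coefficient of f at m and << c *g m >> the term c x^m. *)
Notation polynomials k I := {malg k[{cmonom I}]}.

Section Ideals.
Variable R : comNzRingType.
Implicit Types (I S : set R) (p q : R).

(* idealr of ring_quotient excludes the unit ideal, hence this definition. *)
Record is_ideal I : Prop := IsIdeal {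
  ideal0 : I 0;
  idealD : forall p q, I p -> I q -> I (p + q);
  idealM : forall p q, I q -> I (p * q) }.

Definition ideal_gen S : set R := smallest is_ideal S.

Definition divides p q : Prop := exists h, q = h * p.

End Ideals.

Section Groebner.
Variables (k : fieldType) (I : choiceType).
Implicit Types (le : rel {cmonom I}) (a b c m : {cmonom I}).
Implicit Types (f g h r : polynomials k I) (B G J : set (polynomials k I)).

Record monomial_order le : Prop := MonomialOrder {
  mo_refl : reflexive le;
  mo_anti : antisymmetric le;
  mo_trans : transitive le;
  mo_total : total le;
  mo_wf : ~ exists s : nat -> {cmonom I},
            forall n, le (s n.+1) (s n) /\ s n.+1 <> s n;
  mo_add : forall a b c, le a b -> le (mmul a c) (mmul b c);
  mo_ge0 : forall a, le mone a }.

(* Degrees live in option {cmonom I}, with None playing the role of bottom. *)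
Definition le_bot le (x y : option {cmonom I}) : bool :=
  match x, y with
  | None, _ => true
  | Some _, None => false
  | Some a, Some b => le a b
  end.

(* The filtered list consists of the maximum of the support of f alone when le
   is a monomial order and f != 0, and is empty when f = 0. *)
Definition deg le f : option {cmonom I} :=
  ohead [seq m <- msupp f | all (fun j => le j m) (msupp f)].

Definition LC le f : k := if deg le f is Some m then f@_m else 0.

Definition LM le f : polynomials k I :=
  if deg le f is Some m then << m >> else 0.

Definition LT le f : polynomials k I := LC le f *: LM le f.

(* A finitely supported family indexed by B is encoded by its extension by
   zero, a finitely supported function whose support lies in B. *)
Definition is_remainder le f B r : Prop :=
  exists g : {fsfun polynomials k I -> polynomials k I with 0},
    [/\ forall h, h \in finsupp g -> B h,
        f = \sum_(h <- finsupp g) g h * h + r,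
        forall h, B h -> le_bot le (deg le (g h * h)) (deg le f)
      & forall m h, m \in msupp r -> B h -> h != 0 ->
          ~ divides (LM le h) << r@_m *g m >>].

Definition is_groebner_basis le G J : Prop :=
  [/\ is_ideal J, G `<=` J
    & ideal_gen (LT le @` G) = ideal_gen (LT le @` J)].

Definition lcm_cmonom a b : {cmonom I} :=
  [cmonom maxn (a i) (b i) | i in (finsupp a `|` finsupp b)%fset]%M.

Definition Spoly le f g : polynomials k I :=
  match deg le f, deg le g with
  | Some a, Some b =>
      << LC le g *g divcm (lcm_cmonom a b) a >> * f
      - << LC le f *g divcm (lcm_cmonom a b) b >> * g
  | _, _ => 0
  end.

End Groebner.

(* Main.v *)
(* If S-polynomials have remainder 0, then, modulo combinations of products
   x^a g (g in G) of degree < m, the products of degree exactly m are pairwise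
   proportional. So if f is a combination of products of degree <= m and its
   coefficient at m is 0, then f is already a combination of products of
   degree < m; by well-founded induction on m, deg f is the degree of some
   product x^a g. Conversely, over a Groebner basis, the division algorithm
   reduces any element of the ideal to 0. *)
Require Import Defs.
From mathcomp Require Import all_boot all_order all_algebra.
From mathcomp Require Import finmap monalg.
From mathcomp Require Import boolp classical_sets.
From mathcomp Require Import zify.

Set Implicit Arguments.
Unset Strict Implicit.
Unset Printing Implicit Defensive.

Import GRing.Theory.

(** * Generated ideals *)

Section IdealGen.
Local Open Scope classical_set_scope.
Local Open Scope ring_scope.
Variable R : comNzRingType.
Implicit Types (J S : set R) (p : R).

Lemma ideal_gen_is_ideal S : is_ideal (ideal_gen S).
Proof.
split=> [J [] // [] //|p q Sp Sq J hJ|p q Sq J hJ].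
- by apply: (idealD hJ.1); [exact: Sp|exact: Sq].
- by apply: (idealM hJ.1); exact: Sq.
Qed.

Lemma sub_ideal_gen S : S `<=` ideal_gen S.
Proof. by move=> p Sp J [_]; exact. Qed.

Lemma ideal_gen_min S J : is_ideal J -> S `<=` J -> ideal_gen S `<=` J.
Proof. by move=> hJ SJ p; apply; split. Qed.

Lemma ideal_gen_mono S S' : S `<=` S' -> ideal_gen S `<=` ideal_gen S'.
Proof.
move=> sub; apply: ideal_gen_min; first exact: ideal_gen_is_ideal.
exact: subset_trans sub (@sub_ideal_gen S').
Qed.

End IdealGen.

(** * Arithmetic of terms and least common multiples of monomials *)

Section Monomials.
Local Open Scope ring_scope.
Variables (k : fieldType) (I : choiceType).
Implicit Types (a b m x y : {cmonom I}) (f g : polynomials k I).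

Lemma mmulIm a : injective (mmul^~ a).
Proof.
move=> x y /eqP/cmP e; apply/eqP/cmP => i.
by have := e i; rewrite !cmM => /addIn.
Qed.

Lemma mmulmI a : injective (mmul a).
Proof. by move=> x y; rewrite !(mulmC a); exact: mmulIm. Qed.

Lemma malgMUU (c d : k) a b :
  << c *g a >> * << d *g b >> = << c * d *g mmul a b >> :> polynomials k I.
Proof. exact: fgmulUU. Qed.

Lemma malgUMA (c d : k) a b f :
  << c *g a >> * (<< d *g b >> * f) = << c * d *g mmul a b >> * f.
Proof. by rewrite [LHS]mulrA [X in X * _]malgMUU. Qed.

Lemma malgXMB (c d : k) a x y f g :
  << a >> * (<< c *g x >> * f - << d *g y >> * g) =
  << c *g mmul a x >> * f - << d *g mmul a y >> * g.
Proof.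
rewrite [LHS]mulrBr [X in X - _ = _]malgUMA [X in _ - X = _]malgUMA.
by rewrite (mul1r c) (mul1r d).
Qed.

Lemma malgZU (c d : k) a :
  c *: << d *g a >> = << c * d *g a >> :> polynomials k I.
Proof. by rewrite -mul_malgC malgMUU mul1m. Qed.

Lemma malgZUM (c d : k) a f : c *: (<< d *g a >> * f) = << c * d *g a >> * f.
Proof. by rewrite scalerAl malgZU. Qed.

(** Used with [d] and [e] the leading coefficients of [g] and [f]: a multiple of their cancelling
    difference trades the product with [f] for one with [g], which merges with the product of [g]
    already present. *)
Lemma malg_lead_swap (c c' d e : k) x y f g h : d != 0 ->
  (c / d) *: (<< d *g x >> * f - << e *g y >> * g) + (h - << c' *g y >> * g) =
  << c *g x >> * f + h - << c' + c / d * e *g y >> * g.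
Proof.
move=> d0.
have aux (r : k) (u v u' v' w w' t : polynomials k I) :
    r *: u = u' -> r *: v = v' -> w' = w + v' ->
    r *: (u - v) + (t - w) = u' + t - w'.
  by move=> <- <- ->; rewrite scalerBr opprD addrACA [- w - _]addrC.
apply: aux; [by rewrite malgZUM divfK|exact: malgZUM|].
by rewrite monalgUD mulrDl.
Qed.

Lemma mcoeffUM (c : k) a b f : (<< c *g a >> * f)@_(mmul a b) = c * f@_b.
Proof.
rewrite [in LHS](monalgE f) mulr_sumr raddf_sum /= [in RHS](monalgE f).
rewrite raddf_sum mulr_sumr /=; apply: eq_bigr => x _.
by rewrite malgMUU !mcoeffU (inj_eq (@mmulmI a)) mulrnAr.
Qed.

Lemma msuppUM (c : k) a f m : m \in msupp (<< c *g a >> * f) ->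
  exists2 b, b \in msupp f & m = mmul a b.
Proof.
move=> /msuppM_le [x] [b] [hx hb ->]; exists b => //.
by have /fsubsetP/(_ _ hx) := @msuppU_le _ _ a c; rewrite inE => /eqP ->.
Qed.

Lemma lcm_cmonomE a b i : lcm_cmonom a b i = maxn (a i) (b i).
Proof.
by rewrite cmE fsfun_fun in_fsetE; case: (finsuppP a); case: (finsuppP b).
Qed.

Lemma lcm_cmonom_divl a b : mmul (divcm (lcm_cmonom a b) a) a = lcm_cmonom a b.
Proof. by apply/eqP/cmP => i; rewrite cmM divcmE lcm_cmonomE; lia. Qed.

Lemma lcm_cmonom_divr a b : mmul (divcm (lcm_cmonom a b) b) b = lcm_cmonom a b.
Proof. by apply/eqP/cmP => i; rewrite cmM divcmE lcm_cmonomE; lia. Qed.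

(** A common multiple of two monomials is a multiple of their lcm; [z] is the cofactor. *)
Lemma lcm_cmonom_factor a b x y : mmul x a = mmul y b ->
  exists z, [/\ x = mmul z (divcm (lcm_cmonom a b) a),
                y = mmul z (divcm (lcm_cmonom a b) b)
              & mmul x a = mmul z (lcm_cmonom a b)].
Proof.
move=> /eqP/cmP e; exists (divcm (mmul x a) (lcm_cmonom a b)).
split; apply/eqP/cmP => i; have := e i;
  rewrite !cmM !divcmE ?cmM lcm_cmonomE; lia.
Qed.

End Monomials.

(** * Monomial orders, degrees and leading terms *)

Section Groebner.
Local Open Scope classical_set_scope.
Local Open Scope ring_scope.
Variables (k : fieldType) (I : choiceType) (le : rel {cmonom I}).
Hypothesis hle : monomial_order le.
Implicit Types (a b d m x y : {cmonom I}) (f g h p q : polynomials k I).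
Implicit Types (G : set (polynomials k I)) (D : {cmonom I} -> Prop).

Let lt x y : Prop := le x y /\ x <> y.

Lemma mo_ltW x y : lt x y -> le x y. Proof. by case. Qed.

Lemma mo_le_anti x y : le x y -> le y x -> x = y.
Proof. by move=> xy yx; apply: (mo_anti hle); rewrite xy. Qed.

Lemma mo_le_lt_trans x y d : le x y -> lt y d -> lt x d.
Proof.
move=> xy [yd ne]; split; first exact: (mo_trans hle) xy yd.
by move=> e; apply: ne; apply: mo_le_anti => //; rewrite -e.
Qed.

Lemma mo_le_eqVlt x y : le x y -> x = y \/ lt x y.
Proof. by move=> xy; have [->|/eqP ne] := eqVneq x y; [left|right]. Qed.

Lemma mo_addl a x y : le x y -> le (mmul a x) (mmul a y).
Proof. by rewrite !(mulmC a); exact: (mo_add hle). Qed.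

Lemma mo_addl_lt a x y : lt x y -> lt (mmul a x) (mmul a y).
Proof. by case=> xy ne; split; [exact: mo_addl|move=> /mmulmI]. Qed.

Lemma mo_lt_wf : well_founded lt.
Proof.
move=> x0; apply: contrapT => nacc.
(* Below every inaccessible element lies another one; iterating a choice of such elements gives an
   infinite strictly descending chain. *)
have /choice [s hs] : forall x, exists y, ~ Acc lt x -> lt y x /\ ~ Acc lt y.
  move=> x; case: (pselect (Acc lt x)) => [hx|hx]; first by exists x.
  apply: contrapT => no; apply: hx; constructor => y yx.
  by apply: contrapT => hy; apply: no; exists y.
apply: (mo_wf hle); exists (fun n => iter n s x0) => n.
have nn : ~ Acc lt (iter n s x0) by elim: n => //= n /hs [].
by have [] := hs _ nn.
Qed.

Lemma deg_Some f m :
  deg le f = Some m <-> m \in msupp f /\ {in msupp f, forall j, le j m}.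
Proof.
split.
  rewrite /deg; case E : [seq _ <- _ | _] => [//|y s] [<-].
  have : y \in y :: s by rewrite mem_head.
  by rewrite -E mem_filter => /andP[/allP hy ?].
case=> mf hm; rewrite /deg.
(* By antisymmetry the support has only one upper bound inside itself, so the filtered list contains
   nothing but [m]. *)
have memE y : (y \in [seq x <- msupp f | all (le^~ x) (msupp f)]) = (y == m).
  rewrite mem_filter; apply/andP/eqP => [[/allP hy yf]|->].
    by apply: mo_le_anti; [exact: hm|exact: hy].
  by split=> //; apply/allP.
case E : [seq _ <- _ | _] => [|y s] /=; first by have := memE m; rewrite E eqxx.
by congr Some; apply/eqP; rewrite -memE E mem_head.
Qed.

Lemma deg_exists f : f != 0 -> exists m, deg le f = Some m.
Proof.
rewrite -msupp_eq0 => /fset0Pn [x0 x0f].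
suff [m mf hm] : exists2 m, m \in msupp f & {in msupp f, forall j, le j m}.
  by exists m; apply/deg_Some.
(* Passing from supports to arbitrary nonempty lists makes induction possible. *)
suff gen (s : seq {cmonom I}) : x0 \in s ->
    exists2 m, m \in s & {in s, forall j, le j m} by exact: gen.
elim: s x0 {x0f} => // x s ih y _; case: s ih => [|z s] ih.
  exists x; rewrite ?mem_head // => j; rewrite inE => /eqP ->.
  exact: (mo_refl hle).
have [m ms hm] := ih z (mem_head _ _).
have [mx|xm] := orP (mo_total hle m x).
  exists x; rewrite ?mem_head // => j; rewrite inE => /orP[/eqP ->|/hm jm].
    exact: (mo_refl hle).
  exact: (mo_trans hle) jm mx.
by exists m => [|j]; rewrite in_cons ?ms ?orbT // => /orP[/eqP ->|/hm].
Qed.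

Lemma deg0 : deg le (0 : polynomials k I) = None.
Proof.
case E : (deg _ _) => [m|//].
by have /deg_Some [] := E; rewrite msupp0 inE.
Qed.

Lemma deg_None f : deg le f = None -> f = 0.
Proof.
by move=> e; apply/eqP/negPn/negP => /deg_exists [m]; rewrite e.
Qed.

Lemma le_bot_deg f d :
  le_bot le (deg le f) (Some d) <-> {in msupp f, forall j, le j d}.
Proof.
split=> [|h].
  case E : (deg _ _) => [m|] /=; last by rewrite (deg_None E) msupp0 => _ j.
  by have /deg_Some [_ hm] := E => md j /hm jm; exact: (mo_trans hle) jm md.
by case E : (deg _ _) => [m|] //=; have /deg_Some [mf _] := E; exact: h.
Qed.

Lemma LC_deg f m : deg le f = Some m -> LC le f = f@_m.
Proof. by rewrite /LC => ->. Qed.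

Lemma LC_neq0 f m : deg le f = Some m -> LC le f != 0.
Proof. by move=> e; rewrite (LC_deg e) mcoeff_neq0; have /deg_Some [] := e. Qed.

Lemma LT_deg f m : deg le f = Some m -> LT le f = << LC le f *g m >>.
Proof.
by rewrite /LT /LM => ->; rewrite malgZU mulr1.
Qed.

Lemma LT0 : LT le (0 : polynomials k I) = 0.
Proof. by rewrite /LT /LM deg0 scaler0. Qed.

(** After the leading term of [p] is split off, no other pair of exponents reaches [a + b]:
    [x <= a], [y <= b] and [x + y = a + b] force [x = a], which has left the support. *)
Lemma mcoeffM_deg p q a b : deg le p = Some a -> deg le q = Some b ->
  (p * q)@_(mmul a b) = p@_a * q@_b.
Proof.
move=> /deg_Some [_ pa] /deg_Some [_ qb].
rewrite -{1}(subrK << p@_a *g a >> p) mulrDl mcoeffD [X in _ + X]mcoeffUM.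
rewrite mcoeff_outdom ?add0r //; apply/negP => /msuppM_le [x] [y] [hx hy e].
have xa : le x a.
  move: (hx) => /(fsubsetP (msuppB_le _ _)); rewrite in_fsetU.
  case/orP => [/pa //|/(fsubsetP msuppU_le)].
  by rewrite inE => /eqP ->; exact: (mo_refl hle).
have xE : x = a.
  apply: (@mmulIm _ b); apply: mo_le_anti; first exact: (mo_add hle).
  by rewrite e; apply: mo_addl; exact: qb.
by move: hx; rewrite xE -mcoeff_neq0 mcoeffB mcoeffUU subrr eqxx.
Qed.

(** * Combinations of products with bounded degrees *)

(** [D] constrains the degree of each product [x^a g] and not that of the sum, so the definition
    keeps track of how far leading terms cancel. Building the sum term by term allows induction on
    representations. *)
Inductive span G D : polynomials k I -> Prop :=
| span0 : span G D 0
| spanS c a b g f : G g -> deg le g = Some b -> D (mmul a b) ->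
    span G D f -> span G D (<< c *g a >> * g + f).

Arguments span0 {G D}.

Lemma span1 G D c a b g : G g -> deg le g = Some b -> D (mmul a b) ->
  span G D (<< c *g a >> * g).
Proof.
move=> Gg gb Dab; rewrite -[X in span _ _ X]addr0.
exact: (spanS c Gg gb Dab span0).
Qed.

Lemma spanD G D f g : span G D f -> span G D g -> span G D (f + g).
Proof.
move=> hf hg; elim: hf => [|c a b h f' Gh hb Dab _ ih]; first by rewrite add0r.
by rewrite -addrA; exact: (spanS c Gh hb Dab ih).
Qed.

Lemma span_sum G D (T : eqType) (s : seq T) (F : T -> polynomials k I) :
  {in s, forall i, span G D (F i)} -> span G D (\sum_(i <- s) F i).
Proof.
move=> h; rewrite big_seq; elim/big_rec: _ => [|i f si]; first exact: span0.
by apply: spanD; exact: h.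
Qed.

Lemma spanUM G D D' c a f : (forall x, D x -> D' (mmul a x)) ->
  span G D f -> span G D' (<< c *g a >> * f).
Proof.
move=> DD'; elim=> [|c' a' b h f' Gh hb Dab _ ih].
  by rewrite mulr0; exact: span0.
rewrite mulrDr malgUMA; apply: (spanS _ Gh hb _ ih).
by rewrite -mulmA; exact: DD'.
Qed.

Lemma spanZ G D c f : span G D f -> span G D (c *: f).
Proof. by rewrite -mul_malgC; apply: spanUM => x; rewrite mul1m. Qed.

Lemma spanW G D D' f : (forall x, D x -> D' x) -> span G D f -> span G D' f.
Proof.
move=> DD'; elim=> [|c a b h f' Gh hb Dab _ ih]; first exact: span0.
exact: (spanS c Gh hb (DD' _ Dab)).
Qed.

(** Finitely many products have a largest degree, and it still satisfies [D]. The alternative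
    [f = 0] covers the empty combination, which has no such degree. *)
Lemma span_le G D f :
  span G D f -> f = 0 \/ exists2 m, D m & span G (le^~ m) f.
Proof.
elim=> [|c a b g f' Gg gb Dab _ ih]; first by left.
right; case: ih => [->|[m Dm hf]].
  rewrite addr0; exists (mmul a b) => //; apply: (span1 c Gg gb).
  exact: (mo_refl hle).
have [mab|abm] := orP (mo_total hle m (mmul a b)).
  exists (mmul a b) => //; apply: (spanS c Gg gb); first exact: (mo_refl hle).
  by apply: spanW hf => x xm; exact: (mo_trans hle) xm mab.
by exists m => //; exact: (spanS c Gg gb).
Qed.

Lemma msupp_span G D f m :
  span G D f -> m \in msupp f -> exists2 x, D x & le m x.
Proof.
elim=> [|c a b g f' Gg /deg_Some [_ gb] Dab _ ih]; first by rewrite msupp0.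
move=> /(fsubsetP (msuppD_le _ _)); rewrite in_fsetU => /orP[|//].
by move=> /msuppUM [y /gb yb ->]; exists (mmul a b) => //; exact: mo_addl.
Qed.

Lemma mcoeff_span_lt G f m : span G (lt^~ m) f -> f@_m = 0.
Proof.
move=> hf; apply: mcoeff_outdom; apply/negP => /(msupp_span hf) [x [xm ne] mx].
by apply: ne; exact: mo_le_anti.
Qed.

(** Over a field leading coefficients multiply to something nonzero, so [deg p + deg h] is attained
    in [p * h] and is at most [d]; it bounds every product of a term of [p] with [h]. *)
Lemma span_mul G p h d : G h -> {in msupp (p * h), forall m, le m d} ->
  span G (le^~ d) (p * h).
Proof.
move=> Gh hd.
have [->|/deg_exists [b hb]] := eqVneq h 0; first by rewrite mulr0; exact: span0.
have [->|/deg_exists [a pa]] := eqVneq p 0; first by rewrite mul0r; exact: span0.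
have abd : le (mmul a b) d.
  apply: hd; rewrite -mcoeff_neq0 (mcoeffM_deg pa hb) mulf_neq0 //.
    by rewrite -(LC_deg pa) (LC_neq0 pa).
  by rewrite -(LC_deg hb) (LC_neq0 hb).
rewrite [p]monalgE mulr_suml; apply: span_sum => x xp; apply: (span1 _ Gh hb).
apply: (mo_trans hle) abd; apply: (mo_add hle).
by have /deg_Some [_] := pa; apply.
Qed.

Lemma span_ideal G f : ideal_gen G f -> span G (fun=> True) f.
Proof.
move: f; apply: ideal_gen_min; last first.
  move=> g Gg; have [->|/deg_exists [b gb]] := eqVneq g 0; first exact: span0.
  rewrite -[g]mul1r; exact: (@span1 _ _ 1 mone b).
split=> [|p q|p q hq]; [exact: span0|exact: spanD|].
rewrite [p]monalgE mulr_suml; apply: span_sum => x _.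
by apply: spanUM hq.
Qed.

Lemma ideal_span G D f : span G D f -> ideal_gen G f.
Proof.
have hI := ideal_gen_is_ideal G.
elim=> [|c a b g f' Gg _ _ _ ih]; first exact: (ideal0 hI).
by apply: (idealD hI) => //; apply: (idealM hI); exact: sub_ideal_gen.
Qed.

(** * Degrees of S-polynomials *)

Lemma Spoly_deg f g a b : deg le f = Some a -> deg le g = Some b ->
  {in msupp (Spoly le f g), forall m, lt m (lcm_cmonom a b)}.
Proof.
move=> fa gb m; rewrite /Spoly fa gb => mS; split.
  have /deg_Some [_ la] := fa; have /deg_Some [_ lb] := gb.
  move: mS => /(fsubsetP (msuppB_le _ _)); rewrite in_fsetU.
  case/orP => /msuppUM [x xf ->].
    by rewrite -{2}(lcm_cmonom_divl a b); apply: mo_addl; exact: la.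
  by rewrite -{2}(lcm_cmonom_divr a b); apply: mo_addl; exact: lb.
(* At the lcm both products have coefficient [LC f * LC g], so the difference vanishes there. *)
move=> e; move: mS; rewrite e -mcoeff_neq0 mcoeffB.
have := mcoeffUM (LC le f) (divcm (lcm_cmonom a b) b) b g.
have := mcoeffUM (LC le g) (divcm (lcm_cmonom a b) a) a f.
rewrite lcm_cmonom_divl lcm_cmonom_divr => Ef Eg.
rewrite [X in X - _]Ef [X in _ - X]Eg.
by rewrite -(LC_deg fa) -(LC_deg gb) mulrC subrr eqxx.
Qed.

(** The degree condition on remainders bounds every product by the degree of the S-polynomial, which
    is itself below the lcm. *)
Lemma span_Spoly G f g a b : deg le f = Some a -> deg le g = Some b ->
  is_remainder le (Spoly le f g) G 0 ->
  span G (lt^~ (lcm_cmonom a b)) (Spoly le f g).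
Proof.
move=> fa gb [c [cG]]; rewrite addr0 => SE cdeg _.
have [->|/deg_exists [d Sd]] := eqVneq (Spoly le f g) 0; first exact: span0.
have dl : lt d (lcm_cmonom a b).
  by apply: (Spoly_deg fa gb); have /deg_Some [] := Sd.
rewrite SE; apply: span_sum => h /cG Gh.
apply: (@spanW _ (le^~ d)); first by move=> x xd; exact: mo_le_lt_trans xd dl.
by apply: (span_mul Gh); apply/le_bot_deg; rewrite -Sd; exact: cdeg.
Qed.

(** * From zero remainders of S-polynomials to a Gröbner basis *)

Section Buchberger.
Variable G : set (polynomials k I).
Hypothesis hS : forall f g, G f -> G g -> is_remainder le (Spoly le f g) G 0.

(** The difference is [x^z] times the S-polynomial, where [m] is [z] plus the lcm exponent;
    multiplying by [x^z] carries the bound from the lcm to [m]. *)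
Lemma span_cancel f g a b x y m : G f -> G g ->
  deg le f = Some a -> deg le g = Some b -> mmul x a = m -> mmul y b = m ->
  span G (lt^~ m) (<< LC le g *g x >> * f - << LC le f *g y >> * g).
Proof.
move=> Gf Gg fa gb xa yb.
have [z [xE yE e]] := lcm_cmonom_factor (etrans xa (esym yb)).
have := span_Spoly fa gb (hS Gf Gg).
move=> /(@spanUM _ _ (lt^~ m) 1 z).
rewrite -xa e => /(_ (fun w => @mo_addl_lt z w _)).
by rewrite /Spoly fa gb [X in span _ _ X -> _]malgXMB -xE -yE.
Qed.

(** Induction on the combination, keeping at most one product of degree [m]: each further one is
    exchanged, by [span_cancel], for a multiple of the product already kept. *)
Lemma span_lead m f : span G (le^~ m) f ->
  span G (lt^~ m) f \/ exists c x g b,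
    [/\ G g, deg le g = Some b, mmul x b = m
      & span G (lt^~ m) (f - << c *g x >> * g)].
Proof.
elim=> [|c a b g f' Gg gb /mo_le_eqVlt [abm|abm] _ ih].
- by left; exact: span0.
- right; case: ih => [hf'|[c' [x [h [b' [Gh hb' xb' hf']]]]]].
    by exists c, a, g, b; split=> //; rewrite addrC addKr.
  have h0 := LC_neq0 hb'.
  (* The factor [c / LC h] scales the cancelling difference so that its first product is the new
     term [c x^a g]; its second product adds [c / LC h * LC g] to the old coefficient. *)
  exists (c' + c / LC le h * LC le g), x, h, b'; split; [by []..|].
  rewrite -(malg_lead_swap _ _ _ _ _ _ _ _ h0); apply: spanD hf'.
  exact: spanZ (span_cancel Gg Gh gb hb' abm xb').
- case: ih => [hf'|[c' [x [h [b' [Gh hb' xb' hf']]]]]].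
    by left; exact: (spanS c Gg gb).
  right; exists c', x, h, b'; split=> //; rewrite -addrA.
  exact: (spanS c Gg gb).
Qed.

Lemma Buchberger_deg_dvd f : ideal_gen G f -> f != 0 ->
  exists g b x, [/\ G g, deg le g = Some b & deg le f = Some (mmul x b)].
Proof.
move=> /span_ideal/span_le [->|[m _]]; first by rewrite eqxx.
elim/(well_founded_ind mo_lt_wf): m => m ih hf f0.
have IH : span G (lt^~ m) f -> exists g b x,
    [/\ G g, deg le g = Some b & deg le f = Some (mmul x b)].
  by move=> /span_le [/eqP|[m' lt_m' hf']]; [rewrite (negbTE f0)|exact: (ih m')].
have [/IH //|[c [x [g [b [Gg gb xb hfg]]]]]] := span_lead hf.
(* If the coefficient at [m] is nonzero, then [m] is the degree of [f] and the kept product has that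
   degree. *)
have [fm|fm] := eqVneq f@_m 0; last first.
  exists g, b, x; split=> //; apply/deg_Some; rewrite xb -mcoeff_neq0; split=> //.
  by move=> j /(msupp_span hf) [y ym jy]; exact: (mo_trans hle) jy ym.
(* Otherwise the kept product has coefficient [c * LC g = 0] at [m], so [c = 0] and [f] lies in the
   span strictly below [m]. *)
apply: IH; move: (hfg) => /mcoeff_span_lt.
rewrite mcoeffB fm -xb mcoeffUM sub0r => /eqP; rewrite oppr_eq0 mulf_eq0.
rewrite -(LC_deg gb) (negbTE (LC_neq0 gb)) orbF => /eqP c0.
by move: hfg; rewrite c0 monalgU0 mul0r subr0 xb.
Qed.

Lemma Buchberger_groebner : is_groebner_basis le G (ideal_gen G).
Proof.
split; [exact: ideal_gen_is_ideal|exact: sub_ideal_gen|].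
apply/seteqP; split.
  by apply: ideal_gen_mono => _ [g Gg <-]; exists g => //; exact: sub_ideal_gen.
have hI := ideal_gen_is_ideal (LT le @` G).
apply: ideal_gen_min => // _ [f fI <-].
have [->|f0] := eqVneq f 0; first by rewrite LT0; exact: (ideal0 hI).
have [g [b [x [Gg gb fxb]]]] := Buchberger_deg_dvd fI f0.
rewrite (LT_deg fxb).
(* The leading monomial of [g] divides that of [f], hence [LT f] is a multiple of [LT g]. *)
suff -> : << LC le f *g mmul x b >> = << LC le f / LC le g *g x >> * LT le g.
  by apply: (idealM hI); apply: sub_ideal_gen; exists g.
by rewrite (LT_deg gb) malgMUU divfK // (LC_neq0 gb).
Qed.

End Buchberger.

(** * Division by a Gröbner basis *)

Section Division.
Variable G : set (polynomials k I).
Hypothesis hG : is_groebner_basis le G (ideal_gen G).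

Lemma groebner_deg_dvd f d : ideal_gen G f -> deg le f = Some d ->
  exists g b x, [/\ G g, deg le g = Some b & d = mmul x b].
Proof.
move=> fI fd.
(* [J] is the monomial ideal of the leading monomials of [G], described through supports. As an
   ideal containing all [LT g], it contains [LT f], whose only exponent is [d]. *)
pose J : set (polynomials k I) := fun p => forall m, m \in msupp p ->
  exists g b x, [/\ G g, deg le g = Some b & m = mmul x b].
have hJ : is_ideal J.
  split=> [m|p q hp hq m|p q hq m]; first by rewrite msupp0.
    by move=> /(fsubsetP (msuppD_le _ _)); rewrite in_fsetU => /orP[/hp|/hq].
  move=> /msuppM_le [x] [y] [_ /hq [g [b [z [Gg gb ->]]]] ->].
  by exists g, b, (mmul x z); split=> //; rewrite mulmA.
have : ideal_gen (LT le @` G) (LT le f).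
  by case: hG => _ _ ->; apply: sub_ideal_gen; exists f.
move=> /(ideal_gen_min hJ); apply.
  move=> _ [g Gg <-] m.
  have [->|/deg_exists [b gb]] := eqVneq g 0; first by rewrite LT0 msupp0.
  rewrite (LT_deg gb) => /(fsubsetP msuppU_le); rewrite inE => /eqP ->.
  by exists g, b, mone; split=> //; rewrite mul1m.
by rewrite -mcoeff_neq0 (LT_deg fd) mcoeffUU (LC_neq0 fd).
Qed.

(** One division step per round: subtracting a multiple of some [g] in [G] removes the leading term
    of [f] and stays in the ideal, and the degree drops along a well-founded order. *)
Lemma groebner_span f d : ideal_gen G f -> deg le f = Some d ->
  span G (le^~ d) f.
Proof.
elim/(well_founded_ind mo_lt_wf): d f => d ih f fI fd.
have [g [b [x [Gg gb dE]]]] := groebner_deg_dvd fI fd.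
set t := << LC le f / LC le g *g x >> * g.
have ht : span G (le^~ d) t.
  by apply: (span1 _ Gg gb); rewrite -dE; exact: (mo_refl hle).
have ft : ideal_gen G (f - t).
  apply: (idealD (ideal_gen_is_ideal G)) => //; rewrite -mulN1r.
  by apply: (idealM (ideal_gen_is_ideal G)); exact: ideal_span ht.
rewrite -(subrK t f); apply: spanD => //.
have [->|/deg_exists [d' ftd]] := eqVneq (f - t) 0; first exact: span0.
have /deg_Some [d'ft _] := ftd.
have d'd : lt d' d.
  split.
    move: d'ft => /(fsubsetP (msuppB_le _ _)); rewrite in_fsetU => /orP[].
      by have /deg_Some [_] := fd; apply.
    by move=> /(msupp_span ht) [y yd d'y]; exact: (mo_trans hle) d'y yd.
  (* The coefficient of [t] at [d] is [LC f / LC g * LC g = LC f], so [f - t] has none there. *)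
  move=> e; move: d'ft; rewrite e -mcoeff_neq0 mcoeffB {2}dE mcoeffUM.
  by rewrite -(LC_deg gb) -(LC_deg fd) divfK ?subrr ?eqxx // (LC_neq0 gb).
apply: spanW (ih _ d'd _ ft ftd) => y yd'.
exact: (mo_trans hle) yd' (mo_ltW d'd).
Qed.

End Division.

(** * Zero remainders from bounded combinations *)

Lemma span_sum_fsfun G d f : span G (le^~ d) f ->
  exists c : {fsfun polynomials k I -> polynomials k I with 0},
    [/\ forall h, h \in finsupp c -> G h, f = \sum_(h <- finsupp c) c h * h
      & forall h, {in msupp (c h * h), forall m, le m d}].
Proof.
elim=> [|e a b g f' Gg gb abd _ [c [cG f'E cd]]].
  exists [fsfun]; rewrite finsupp0; split=> [h||h]; first by rewrite inE.
    by rewrite big_seq_fset0.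
  by rewrite fsfun0E mul0r msupp0.
(* The new term is added to the coefficient of [g], where it may cancel. The support of [c'] is thus
   only contained in [A], and the sums are compared over [A]. *)
pose A := (g |` finsupp c)%fset.
pose c' : {fsfun polynomials k I -> polynomials k I with 0} :=
  [fsfun h in A => c h + << e *g a >> *+ (h == g) | 0].
have c'E h : c' h = c h + << e *g a >> *+ (h == g).
  rewrite fsfun_fun; case: ifPn => //; rewrite in_fset1U negb_or.
  by move=> /andP[/negbTE -> /fsfun_dflt ->]; rewrite addr0.
have c'A : (finsupp c' `<=` A)%fset.
  apply/fsubsetP => h; apply: contraLR => hA.
  by rewrite memNfinsupp fsfun_fun (negbTE hA).
exists c'; split=> [h /(fsubsetP c'A)||h].
- by rewrite in_fset1U => /orP[/eqP ->|/cG].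
- rewrite (big_fset_incl _ c'A) /=; last first.
    by move=> h _ /fsfun_dflt ->; rewrite mul0r.
  under eq_bigr do rewrite c'E mulrDl.
  rewrite big_split /= [RHS]addrC; congr (_ + _); last first.
    rewrite f'E; apply: big_fset_incl; first exact: fsubsetU1.
    by move=> h _ /fsfun_dflt ->; rewrite mul0r.
  rewrite (big_fsetD1 g) ?fset1U1 //= eqxx big1_fset ?addr0 // => h.
  by rewrite in_fsetD1 => /andP[/negbTE -> _] _; rewrite mul0r.
- move=> m; rewrite c'E mulrDl => /(fsubsetP (msuppD_le _ _)).
  rewrite in_fsetU => /orP[/cd //|]; have [->|_] := eqVneq h g; last first.
    by rewrite mul0r msupp0.
  move=> /msuppUM [y gy ->]; apply: (mo_trans hle) abd; apply: mo_addl.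
  by have /deg_Some [_] := gb; apply.
Qed.

Lemma groebner_remainder0 G f : is_groebner_basis le G (ideal_gen G) ->
  ideal_gen G f -> is_remainder le f G 0.
Proof.
move=> hG fI; have [->|/deg_exists [d fd]] := eqVneq f 0.
  (* The zero polynomial has degree bottom, so every product must vanish: the zero family is
     taken. *)
  exists [fsfun]; rewrite finsupp0; split=> [h||h _|m h]; first by rewrite inE.
  - by rewrite big_seq_fset0 addr0.
  - by rewrite fsfun0E mul0r deg0.
  - by rewrite msupp0.
have [c [cG fE cd]] := span_sum_fsfun (groebner_span hG fI fd).
exists c; split=> // [|h _|m h]; first by rewrite addr0.
  by rewrite fd; apply/le_bot_deg; exact: cd.
by rewrite msupp0.
Qed.

Lemma Spoly_ideal G f g : G f -> G g -> ideal_gen G (Spoly le f g).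
Proof.
have hI := ideal_gen_is_ideal G.
move=> /sub_ideal_gen Gf /sub_ideal_gen Gg; rewrite /Spoly.
case: (deg le f) => [a|]; last exact: (ideal0 hI).
case: (deg le g) => [b|]; last exact: (ideal0 hI).
rewrite -mulNr; apply: (idealD hI); exact: (idealM hI).
Qed.

End Groebner.

Theorem theorem8 (k : fieldType) (sigma : choiceType)
    (le : rel {cmonom sigma}) (hle : monomial_order le)
    (G : set (polynomials k sigma)) :
  is_groebner_basis le G (ideal_gen G) <->
  (forall f g : polynomials k sigma, G f -> G g ->
     is_remainder le (Spoly le f g) G 0%R).
Proof.
split=> [hG f g Gf Gg|]; last exact: Buchberger_groebner.
by apply: groebner_remainder0 => //; exact: Spoly_ideal.
Qed.
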